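(* Let $(\mathbf r,\mathbf c)$ be an $m\times n$ margin. Then the following are equivalent: (1) an MLE $(\boldsymbol\alpha,\boldsymbol\beta)$ for $(\mathbf r,\mathbf c)$ exists; (2) the typical table $Z^{\mathbf r,\mathbf c}$ exists; (3) $\mathcal T(\mathbf r,\mathbf c)\cap (A,B)^{m\times n}\neq\emptyset$. If they exist, then for every $(\boldsymbol\alpha,\boldsymbol\beta)\in\mathbb R^m\times\mathbb R^n$ with $\boldsymbol\alpha(i)+\boldsymbol\beta(j)\in\Theta^\circ$ for all $i,j$, $$(\boldsymbol\alpha,\boldsymbol\beta)\text{ is an MLE for }(\mathbf r,\mathbf c)\iff \psi'(\boldsymbol\alpha\oplus\boldsymbol\beta)\in\mathcal T(\mathbf r,\mathbf c)\iff Z^{\mathbf r,\mathbf c}=\psi'(\boldsymbol\alpha\oplus\boldsymbol\beta),$$ where $\psi'(\boldsymbol\alpha\oplus\boldsymbol\beta)$ is the mean matrix of the product measure $\bigotimes_{i,j}\mu_{\boldsymbol\alpha(i)+\boldsymbol\beta(j)}$. Furthermore, strong duality holds: $$\inf_{Z\in\mathcal T(\mathbf r,\mathbf c)}H(Z)=\sup_{\boldsymbol\alpha,\boldsymbol\beta} g^{\mathbf r,\mathbf c}(\boldsymbol\alpha,\boldsymbol\beta),$$ the supremum being over all $(\boldsymbol\alpha,\boldsymbol\beta)$ with $\boldsymbol\alpha(i)+\boldsymbol\beta(j)\in\Theta^\circ$ for all $i,j$.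
   Context: Let $\mu$ be a $\sigma$-finite Borel measure on $\mathbb R$, $A=\inf\operatorname{supp}\mu$, $B=\sup\operatorname{supp}\mu$ (possibly infinite). Let $\Theta=\{\theta\in\mathbb R:\int e^{\theta x}\mu(dx)<\infty\}$, assumed nonempty and not a singleton (hence an interval), with interior $\Theta^\circ$; $\psi(\theta)=\log\int e^{\theta x}\mu(dx)$; for $\theta\in\Theta^\circ$, $\mu_\theta$ is the probability measure $\mu_\theta(dx)=e^{\theta x-\psi(\theta)}\mu(dx)$, with mean $\psi'(\theta)$ and variance $\psi''(\theta)$. Standing assumption: $\psi''>0$ on $\Theta^\circ$ and $\psi':\Theta^\circ\to(A,B)$ is a (strictly increasing) bijection, with inverse $\phi:(A,B)\to\Theta^\circ$. An $m\times n$ margin is a pair $(\mathbf r,\mathbf c)\in\mathbb R^m\times\mathbb R^n$. $\mathcal T(\mathbf r,\mathbf c)$ is the set of real $m\times n$ matrices with row sums $\mathbf r$ and column sums $\mathbf c$. $\boldsymbol\alpha\oplus\boldsymbol\beta$ is the $m\times n$ matrix with $(i,j)$ entry $\boldsymbol\alpha(i)+\boldsymbol\beta(j)$; univariate functions act entrywise on matrices. $g^{\mathbf r,\mathbf c}(\boldsymbol\alpha,\boldsymbol\beta)=\langle\mathbf r,\boldsymbol\alpha\rangle+\langle\mathbf c,\boldsymbol\beta\rangle-\sum_{i,j}\psi(\boldsymbol\alpha(i)+\boldsymbol\beta(j))$. An MLE for $(\mathbf r,\mathbf c)$ is a maximizer of $g^{\mathbf r,\mathbf c}$ over all $(\boldsymbol\alpha,\boldsymbol\beta)$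 with $\boldsymbol\alpha(i)+\boldsymbol\beta(j)\in\Theta^\circ$ for all $i,j$. For $z\in(A,B)$ let $D(\mu_{\phi(z)}\|\mu)=z\phi(z)-\psi(\phi(z))$, and set this quantity to $+\infty$ for $z\notin(A,B)$. $H(Z)=\sum_{i,j}D(\mu_{\phi(z_{ij})}\|\mu)$ for $Z=(z_{ij})\in\mathbb R^{m\times n}$. The typical table $Z^{\mathbf r,\mathbf c}$ is the (unique, if it exists) minimizer of $H$ over $\mathcal T(\mathbf r,\mathbf c)$ with finite value $H(Z^{\mathbf r,\mathbf c})<\infty$. *)

(* Defs.v *)
From HB Require Import structures.
From mathcomp Require Import all_boot all_order all_algebra.
From mathcomp Require Import all_classical all_reals all_analysis.

Set Implicit Arguments.
Unset Strict Implicit.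
Unset Printing Implicit Defensive.

Import Order.TTheory GRing.Theory Num.Theory.
Import numFieldNormedType.Exports.

Local Open Scope ring_scope.
Local Open Scope classical_set_scope.

Section exponential_family.
Context {R : realType}.
Variable mu : {measure set (measurableTypeR R) -> \bar R}.

Definition msupport : set R :=
  [set x | forall U : set R, open U -> U x -> (0 < mu U)%E].

Definition supp_inf : \bar R := ereal_inf (EFin @` msupport).

Definition supp_sup : \bar R := ereal_sup (EFin @` msupport).

(** The open interval (A, B), as a set of real numbers. *)
Definition mean_domain : set R :=
  [set z | (supp_inf < z%:E < supp_sup)%E].

Definition laplace (t : R) : \bar R := (\int[mu]_x (expR (t * x))%:E)%E.

Definition Theta : set R := [set t | (laplace t < +oo)%E].

(** Meaningful only for [t] in [Theta], where [laplace t] is finite. *)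
Definition psi (t : R) : R := ln (fine (laplace t)).

(** The set function [mu_t], whose density with respect to [mu] is
    exp (t x - psi t). *)
Definition tilt (t : R) (S : set R) : \bar R :=
  (\int[mu]_(x in S) (expR (t * x - psi t))%:E)%E.

(** Inverse of [psi^`()] from [mean_domain] to the interior of [Theta];
    meaningful only when [psi^`()] is a bijection between these sets. *)
Definition phi : R -> R := 'pinv_(fun=> 0) Theta° psi^`().

(** The relative entropy D(mu_(phi z) || mu), extended by +oo. *)
Definition rel_entropy (z : R) : \bar R :=
  if (supp_inf < z%:E < supp_sup)%E then (z * phi z - psi (phi z))%:E
  else +oo%E.

End exponential_family.

Section tables.
Context {R : realType} {m n : nat}.

Definition margin_tables (r : 'rV[R]_m) (c : 'rV[R]_n) : set 'M[R]_(m, n) :=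
  [set Z : 'M[R]_(m, n) | (forall i, \sum_j Z i j = r 0 i) /\
                          (forall j, \sum_i Z i j = c 0 j)].

Definition oplus (a : 'rV[R]_m) (b : 'rV[R]_n) : 'M[R]_(m, n) :=
  \matrix_(i, j) (a 0 i + b 0 j).

Variable mu : {measure set (measurableTypeR R) -> \bar R}.

Definition admissible (a : 'rV[R]_m) (b : 'rV[R]_n) : Prop :=
  forall i j, (Theta mu)° (oplus a b i j).

Definition loglik (r : 'rV[R]_m) (c : 'rV[R]_n)
    (a : 'rV[R]_m) (b : 'rV[R]_n) : R :=
  \sum_i r 0 i * a 0 i + \sum_j c 0 j * b 0 j
  - \sum_i \sum_j psi mu (oplus a b i j).

Definition is_MLE (r : 'rV[R]_m) (c : 'rV[R]_n)
    (a : 'rV[R]_m) (b : 'rV[R]_n) : Prop :=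
  admissible a b /\
  forall a' b', admissible a' b' -> loglik r c a' b' <= loglik r c a b.

Definition table_entropy (Z : 'M[R]_(m, n)) : \bar R :=
  (\sum_i \sum_j rel_entropy mu (Z i j))%E.

Definition is_typical_table (r : 'rV[R]_m) (c : 'rV[R]_n)
    (Z : 'M[R]_(m, n)) : Prop :=
  [/\ margin_tables r c Z, (table_entropy Z < +oo)%E &
      forall Z', margin_tables r c Z' -> (table_entropy Z <= table_entropy Z')%E].

Definition mean_table (a : 'rV[R]_m) (b : 'rV[R]_n) : 'M[R]_(m, n) :=
  map_mx ((psi mu)^`()) (oplus a b).

End tables.

Section product_law.
Context {R : realType} {m n : nat}.

(** Generators of the product sigma-algebra on m x n real matrices. *)
Definition mx_cylinders : set (set 'M[R]_(m, n)) :=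
  [set C | exists i j, exists2 S : set (measurableTypeR R),
     measurable S & C = [set Z : 'M[R]_(m, n) | S (Z i j)]].

Definition mx_measurable := g_sigma_algebraType mx_cylinders.

(** [P] is the product of the laws [nu i j]: it is determined by its values on
    measurable boxes. *)
Definition is_product_law (nu : 'I_m -> 'I_n -> set R -> \bar R)
    (P : probability mx_measurable R) : Prop :=
  forall S : 'I_m -> 'I_n -> set (measurableTypeR R),
    (forall i j, measurable (S i j)) ->
    P [set Z : 'M[R]_(m, n) | forall i j, S i j (Z i j)] =
      (\prod_i \prod_j nu i j (S i j))%E.

Definition has_mean_matrix (P : probability mx_measurable R)
    (M : 'M[R]_(m, n)) : Prop :=
  forall i j, ('E_P[fun Z : 'M[R]_(m, n) => Z i j] = (M i j)%:E)%E.

End product_law.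

(* Main.v *)
Require Import Defs.
From HB Require Import structures.
From mathcomp Require Import all_boot all_order all_algebra.
From mathcomp Require Import all_classical all_reals all_analysis.
From mathcomp Require Import measurable_realfun ring lra.

Import Order.TTheory GRing.Theory Num.Theory.
Import numFieldNormedType.Exports.

Local Open Scope ring_scope.
Local Open Scope classical_set_scope.

(** On the open interval I = Theta° the function psi is differentiable (the
    Laplace transform is differentiated under the integral sign) with strictly
    increasing derivative, so the entropy is the convex conjugate of psi:
    z t - psi t <= D(z), with equality exactly when z = psi' t. Summed over the
    entries this is weak duality, with equality exactly when
    Z = psi'(alpha (+) beta); together with the first-order conditions of the
    likelihood it yields everything except the existence of an MLE when
    T(r, c) meets (A, B)^(m x n).

    For the existence, write Z = (psi' p_ij), fix s in I and maximise the
    likelihood over the sums theta = alpha (+) beta with entries in a compact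
    interval [a, b] of I containing s. The first-order inequality in the direction
    of the constant table s reads sum_ij (psi' theta_ij - z_ij)(theta_ij - s) <= 0.
    Each term is bounded below and tends to +oo at both ends of I, because at a
    finite end of Theta the corresponding end of (A, B) is infinite. Hence the
    maximiser lies in a compact subset of I independent of [a, b]; for [a, b]
    large enough it is a critical point of the likelihood. *)

(** * Convex functions with increasing derivative *)

Section increasing_derivative.
Context {R : realType} {I : set R} {f psi : R -> R}.
Hypothesis itvI : is_interval I.
Hypothesis f_lt : forall x y, I x -> I y -> x < y -> f x < f y.

Lemma incr_le x y : I x -> I y -> x <= y -> f x <= f y.
Proof.
by move=> Ix Iy; rewrite le_eqVlt => /predU1P[->//|xy]; rewrite ltW// f_lt.
Qed.

Hypothesis dpsi : forall t, I t -> is_derive t 1 psi (f t).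

(** By the mean value theorem the chord between [x] and [y] has slope [f c] with [c] strictly
    between them, and strict monotonicity compares [f c] with [f y]. *)
Lemma tangent_lt x y : I x -> I y -> x != y -> psi y + f y * (x - y) < psi x.
Proof.
have mvt u v : I u -> I v -> u < v ->
    exists c, [/\ I c, u < c, c < v & psi v - psi u = f c * (v - u)].
  move=> Iu Iv uv.
  have uvI t : u <= t <= v -> I t by move=> ?; exact: (itvI u v).
  have cpsi : {within `[u, v], continuous psi}.
    apply: derivable_within_continuous => t; rewrite in_itv/= => /uvI.
    by move=> /dpsi[].
  have dpsi' t : t \in `]u, v[%R -> is_derive t 1 psi (f t).
    by rewrite in_itv/= => /andP[ut tv]; apply/dpsi/uvI; rewrite !ltW.
  have [c] := MVT uv dpsi' cpsi.
  rewrite in_itv/= => /andP[uc cv] E; exists c; split => //.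
  by apply: uvI; rewrite !ltW.
move=> Ix Iy; rewrite neq_lt => /orP[xy|yx].
- have [c [Ic xc cy E]] := mvt _ _ Ix Iy xy.
  have := f_lt _ _ Ic Iy cy; nra.
- have [c [Ic yc cx E]] := mvt _ _ Iy Ix yx.
  have := f_lt _ _ Iy Ic yc; nra.
Qed.

Lemma tangent_le x y : I x -> I y -> psi y + f y * (x - y) <= psi x.
Proof.
have [->|xy] := eqVneq x y; first by rewrite subrr mulr0 addr0.
by move=> Ix Iy; rewrite ltW// tangent_lt.
Qed.

(** The tangent inequality rearranged: the supremum defining the convex conjugate of [psi] at [f y]
    is attained at [y] only. *)
Lemma conjugate_lt x y : I x -> I y -> x != y ->
  f y * x - psi x < f y * y - psi y.
Proof. by move=> Ix Iy xy; have := tangent_lt _ _ Ix Iy xy; lra. Qed.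

Lemma conjugate_le x y : I x -> I y -> f y * x - psi x <= f y * y - psi y.
Proof. by move=> Ix Iy; have := tangent_le _ _ Ix Iy; lra. Qed.

Hypothesis oI : open I.

Lemma open_gt x : I x -> exists2 y, I y & x < y.
Proof.
move=> Ix; have : nbhs x I by exact: open_nbhs_nbhs.
move=> /nbhs_ballP[e /= e0 xeI]; exists (x + e / 2); last by lra.
by apply: xeI; rewrite /ball/=; rewrite ltr_norml; lra.
Qed.

Lemma open_lt x : I x -> exists2 y, I y & y < x.
Proof.
move=> Ix; have : nbhs x I by exact: open_nbhs_nbhs.
move=> /nbhs_ballP[e /= e0 xeI]; exists (x - e / 2); last by lra.
by apply: xeI; rewrite /ball/=; rewrite ltr_norml; lra.
Qed.

(** All points are shifted by the same [e], as happens in a row or a column of a sum table when one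
    coordinate moves; the derivative in [e] vanishes at the local maximum [e = 0]. *)
Lemma stationary (k : nat) (t : 'I_k -> R) (rho d : R) :
  0 < d -> (forall i, I (t i)) ->
  (forall e, `|e| < d -> (forall i, I (t i + e)) ->
     rho * e <= \sum_i (psi (t i + e) - psi (t i))) ->
  rho = \sum_i f (t i).
Proof.
move=> d0 It H.
(* There are finitely many indices, so one radius keeps every shifted point in the open set [I]. *)
have : \forall e \near 0^'+, forall i, `]t i - e, t i + e[ `<=` I.
  apply: filter_forall => i.
  have : nbhs (t i) I by exact: open_nbhs_nbhs.
  move=> /nbhs_ballP[e /= e0 teI]; near=> e' => x /= xt.
  apply: teI; rewrite /ball/= distrC ltr_norml.
  have e'e : e' < e by near: e'; exact: nbhs_right_lt.
  by move: xt; rewrite in_itv/=; lra.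
move=> Hn.
have [e [e0 ed eI]] : exists e : R, [/\ 0 < e, e < d &
    forall i, `]t i - e, t i + e[ `<=` I].
  near (0:R)^'+ => e; exists e; split; near: e => //.
  - exact: nbhs_right_gt.
  - exact: nbhs_right_lt.
pose F x := rho * x - \sum_i psi (t i + x).
have dF (x : R) : x \in `]- e, e[%R -> is_derive x 1 F (rho - \sum_i f (t i + x)).
  rewrite in_itv/= => xe; rewrite /F.
  have -> : (fun x => rho * x - \sum_i psi (t i + x)) =
     (rho \*: id) - \sum_i (fun x => psi (t i + x)).
    by apply/funext => y; rewrite !fctE /= fct_sumE.
  apply: is_deriveB.
    by apply: is_derive_eq; rewrite ?scaler1.
  apply: is_derive_sum => i.
  have h : is_derive (t i + x) 1 psi (f (t i + x)).
    by apply: dpsi; apply: (eI i); rewrite /= in_itv/=; lra.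
  have g : is_derive x 1 (fun x => t i + x) 1.
    have -> : (fun x => t i + x) = cst (t i) + id by [].
    by apply: is_derive_eq; rewrite add0r.
  have := @is_derive1_comp _ psi (fun x => t i + x) x _ _ h g.
  by rewrite mulr1.
have e00 : (0 : R) \in `]- e, e[%R by rewrite in_itv/= oppr_lt0 e0.
have D0 : is_derive (0 : R) 1 F 0.
  apply: (@derive1_at_max R F (- e) e 0); first lra.
  - by move=> x /dF[].
  - exact: e00.
  - move=> x; rewrite in_itv/= => xe; rewrite /F mulr0.
    have := H x; rewrite ltr_norml => /(_ ltac:(lra)).
    rewrite sumrB => H'.
    under [X in _ <= _ - X]eq_bigr do rewrite addr0.
    suff : rho * x <= \sum_i psi (t i + x) - \sum_i psi (t i) by lra.
    by apply: H' => i; apply: (eI i); rewrite /= in_itv/=; lra.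
have [_ E1] := D0; have [_] := dF _ e00; rewrite E1.
under [X in _ = _ - X -> _]eq_bigr do rewrite addr0.
lra.
Unshelve. all: end_near. Qed.

End increasing_derivative.

(** * Confinement by an upper bound on [(f t - z) * (t - s)] *)

Section confinement.
Context {R : realType}.

(** Far to the right one factor of the product stays above a positive constant while the other
    exceeds any bound: [t - s] if [I] is unbounded above, [f t - z] if [f] is. *)
Lemma confined_right (I : set R) (f : R -> R) (s z L : R) :
  (forall x y, I x -> I y -> x < y -> f x < f y) ->
  (forall x, exists2 t, I t & x < t) \/ (forall y, exists2 t, I t & y < f t) ->
  (exists2 u, I u & s < u) -> (exists2 t, I t & z < f t) ->
  exists2 b, I b & forall t, I t -> (f t - z) * (t - s) <= L -> t <= b.
Proof.
move=> f_lt ends [u Iu su] [t0 It0 zt0].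
(* A nonnegative bound places the threshold [t1] below at or beyond [s], respectively [f t1] at or
   above [z]. *)
have [L0 [LL0 L00]] : exists L0, L <= L0 /\ 0 <= L0.
  by exists `|L|; rewrite ler_norm normr_ge0.
have Imax x y : I x -> I y -> I (Num.max x y).
  by move=> Ix Iy; rewrite /Num.max; case: ifP.
case: ends => [|] /= ub.
- have [t1 It1] := ub (s + L0 / (f t0 - z)).
  rewrite -ltrBrDl ltr_pdivrMr ?subr_gt0// => t1L.
  have st1 : s <= t1.
    by rewrite -subr_ge0 -(pmulr_lge0 _ (x := f t0 - z)) ?subr_gt0//; lra.
  exists (Num.max t0 t1); first exact: Imax.
  move=> t It Ht; rewrite leNgt gt_max; apply/negP => /andP[t0t t1t].
  have := f_lt _ _ It0 It t0t; nra.
- have [t1 It1] := ub (z + L0 / (u - s)).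
  rewrite -ltrBrDl ltr_pdivrMr ?subr_gt0// => t1L.
  have zt1 : z <= f t1.
    by rewrite -subr_ge0 -(pmulr_lge0 _ (x := u - s)) ?subr_gt0//; lra.
  exists (Num.max u t1); first exact: Imax.
  move=> t It Ht; rewrite leNgt gt_max; apply/negP => /andP[ut t1t].
  have := f_lt _ _ It1 It t1t; nra.
Qed.

(** Changing the sign of both the argument and the value of [f] leaves the product unchanged and
    exchanges the two ends. *)
Lemma confined_left (I : set R) (f : R -> R) (s z L : R) :
  (forall x y, I x -> I y -> x < y -> f x < f y) ->
  (forall x, exists2 t, I t & t < x) \/ (forall y, exists2 t, I t & f t < y) ->
  (exists2 u, I u & u < s) -> (exists2 t, I t & f t < z) ->
  exists2 a, I a & forall t, I t -> (f t - z) * (t - s) <= L -> a <= t.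
Proof.
move=> f_lt ends [u Iu us] [t0 It0 t0z].
have [||||b Ib Hb] :=
  @confined_right [set x | I (- x)] (fun x => - f (- x)) (- s) (- z) L.
- by move=> x y Ix Iy xy; rewrite ltrN2 f_lt// ltrN2.
- case: ends => H; [left|right] => x; have [t It tx] := H (- x);
    by exists (- t); rewrite /= ?opprK// ltrNr.
- by exists (- u); rewrite /= ?opprK ?ltrN2.
- by exists (- t0); rewrite /= opprK ?ltrN2.
- exists (- b) => // t It Ht; rewrite lerNl; apply: Hb; rewrite /= !opprK//.
  by apply: le_trans Ht; rewrite le_eqVlt; apply/orP; left; apply/eqP; ring.
Qed.

End confinement.

(** * Critical points over sum tables *)

Section table_critical_point.
Context {R : realType} (I : set R) (f psi : R -> R).
Hypothesis itvI : is_interval I.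
Hypothesis f_lt : forall x y, I x -> I y -> x < y -> f x < f y.
Hypothesis dpsi : forall t, I t -> is_derive t 1 psi (f t).

Let cpsi t : I t -> {for t, continuous psi}.
Proof. by move=> /dpsi[d _]; exact/differentiable_continuous/derivable1_diffP. Qed.

(** Moving a constant from [al] to [be] preserves all sums, so the constraint set is unbounded; the
    extreme value theorem is applied to a compact part of it that meets every class of vectors with
    the same sums. *)
Lemma box_maximizer m n (z : 'M[R]_(m.+1, n.+1)) (a b : R) :
  a <= b -> I a -> I b ->
  let G := fun (al : 'rV[R]_m.+1) (be : 'rV[R]_n.+1) =>
    \sum_i \sum_j (z i j * (al 0 i + be 0 j) - psi (al 0 i + be 0 j)) in
  let adm := fun (al : 'rV[R]_m.+1) (be : 'rV[R]_n.+1) =>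
    forall i j, a <= al 0 i + be 0 j <= b in
  exists al be, adm al be /\
    forall al' be', adm al' be' -> G al' be' <= G al be.
Proof.
move=> ab Ia Ib G adm.
(* The coordinate bounds are those met by the representative with [al 0 0 = 0]: then each entry of
   [be] is a sum in [[a, b]], and each entry of [al] is a difference of two such sums. *)
pose C : set ('rV[R]_m.+1 * 'rV[R]_n.+1) :=
  ([set v : 'rV[R]_m.+1 | forall i, `[- (b - a), b - a] (v ord0 i)] `*`
   [set v : 'rV[R]_n.+1 | forall j, `[a, b] (v ord0 j)]) `&`
  \bigcap_i \bigcap_j [set p : 'rV[R]_m.+1 * 'rV[R]_n.+1 | `[a, b] (p.1 0 i + p.2 0 j)].
have cadd i j : continuous
    (fun p : 'rV[R]_m.+1 * 'rV[R]_n.+1 => p.1 0 i + p.2 0 j).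
  move=> p; apply: cvgD.
    by apply: (@cvg_comp _ _ _ fst (fun M : 'rV[R]_m.+1 => M 0 i) _ (nbhs p.1));
      [exact: cvg_fst|exact: coord_continuous].
  by apply: (@cvg_comp _ _ _ snd (fun M : 'rV[R]_n.+1 => M 0 j) _ (nbhs p.2));
      [exact: cvg_snd|exact: coord_continuous].
have compactC : compact C.
  apply: compact_closedI.
    apply: compact_setX.
      by apply: (@rV_compact R _ (fun=> `[- (b - a), b - a])) => _; exact: segment_compact.
    by apply: (@rV_compact R _ (fun=> `[a, b])) => _; exact: segment_compact.
  apply: closed_bigI => i _; apply: closed_bigI => j _.
  have cab : closed (`[a, b] : set R) by exact: itv_closed.
  apply: (closed_comp _ cab) => p _; exact: cadd.
have C0 : C !=set0.
  exists (0, const_mx a); split; first split => i /=.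
  - by rewrite mxE in_itv/=; lra.
  - by rewrite mxE in_itv/=; lra.
  - by move=> i _ j _ /=; rewrite !mxE in_itv/=; lra.
have cG : {within C, continuous (fun p => G p.1 p.2)}.
  apply: continuous_in_subspaceT => p /set_mem[_ Cp].
  apply: cvg_big => [|i _]; first exact: add_continuous.
  apply: cvg_big => [|j _]; first exact: add_continuous.
  apply: cvgB; first by apply: cvgM; [exact: cvg_cst|exact: cadd].
  apply: (@continuous_comp _ _ _
    (fun p : 'rV[R]_m.+1 * 'rV[R]_n.+1 => p.1 0 i + p.2 0 j) psi);
    first exact: cadd.
  apply: cpsi; have := Cp i Logic.I j Logic.I; rewrite /= in_itv/=; exact: itvI.
have [[al be] /set_mem /= [_ Cp] max] := compact_EVT_max C0 compactC cG.
exists al, be; split.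
  by move=> i j; have := Cp i Logic.I j Logic.I; rewrite /= in_itv.
(* The objective only depends on the sums, so a point outside the box can be
   shifted back into it without changing the objective. *)
move=> al' be' adm'.
pose al1 : 'rV[R]_m.+1 := al' - const_mx (al' 0 0).
pose be1 : 'rV[R]_n.+1 := be' + const_mx (al' 0 0).
have E i j : al1 0 i + be1 0 j = al' 0 i + be' 0 j.
  by rewrite !mxE; ring.
have -> : G al' be' = G al1 be1.
  by apply: eq_bigr => i _; apply: eq_bigr => j _; rewrite E.
apply: (max (al1, be1)); apply/mem_set; split; first split => i /=.
- rewrite !mxE in_itv/=; have := adm' i 0; have := adm' 0 0; lra.
- rewrite !mxE in_itv/=; have := adm' 0 i; lra.
- by move=> i _ j _ /=; rewrite E in_itv/=; exact: adm'.
Qed.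

Hypothesis oI : open I.

Lemma finite_ubound (T : finType) (g : T -> R) (s : R) :
  I s -> (forall x, I (g x)) -> exists b, [/\ I b, s <= b & forall x, g x <= b].
Proof.
move=> Is Ig; exists (\big[Num.max/s]_x g x); split.
- by elim/big_ind: _ => // x y Ix Iy; rewrite /Num.max; case: ifP.
- exact: bigmax_ge_id.
- by move=> x; exact: le_bigmax.
Qed.

Lemma finite_lbound (T : finType) (g : T -> R) (s : R) :
  I s -> (forall x, I (g x)) -> exists a, [/\ I a, a <= s & forall x, a <= g x].
Proof.
move=> Is Ig; exists (\big[Num.min/s]_x g x); split.
- by elim/big_ind: _ => // x y Ix Iy; rewrite /Num.min; case: ifP.
- exact: bigmin_le_id.
- by move=> x; exact: bigmin_le.
Qed.

(** The product is negative only for [t] between [s] and [p], and there monotonicity bounds both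
    factors by their values at the opposite end. The bound does not depend on [t]. *)
Lemma pairing_lbound (s p t : R) : I s -> I p -> I t ->
  - (`|f s - f p| * `|p - s|) <= (f t - f p) * (t - s).
Proof.
move=> Is Ip It; rewrite -normrM.
have le := @incr_le _ I f f_lt.
have [ts|st] := leP t s; have [tp|pt] := leP t p.
- have := le _ _ It Ip tp; have := normr_ge0 ((f s - f p) * (p - s)); nra.
- have pt' := le _ _ Ip It (ltW pt); have ts' := le _ _ It Is ts.
  have := ler_norm ((f s - f p) * (s - p)).
  rewrite -[s - p]opprB mulrN normrN; nra.
- have tp' := le _ _ It Ip tp; have st' := le _ _ Is It (ltW st).
  have := ler_norm ((f p - f s) * (p - s)).
  rewrite -[f p - f s]opprB mulNr normrN; nra.
- have := le _ _ Ip It (ltW pt); have := normr_ge0 ((f s - f p) * (p - s)); nra.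
Qed.

(** This replaces letting [e] tend to [0]: if [t] were outside, the chosen [e] would move it only
    half way to the violated endpoint. *)
Lemma segment_limit (A B s t : R) : A <= s <= B ->
  (forall e, 0 < e < 1 -> A <= t + e * (s - t) <= B) -> A <= t <= B.
Proof.
move=> sAB H; apply/andP; split; rewrite leNgt; apply/negP => h.
- have st : 0 < s - t by lra.
  have := H ((A - t) / 2 / (s - t)).
  by rewrite divfK ?gt_eqF// divr_gt0 ?ltr_pdivrMr//; lra.
- have st : 0 < t - s by lra.
  have := H ((t - B) / 2 / (t - s)).
  rewrite -[s - t]opprB mulrN divfK ?gt_eqF// divr_gt0 ?ltr_pdivrMr//; lra.
Qed.

Lemma term_le_sum (m n : nat) (u : 'I_m -> 'I_n -> R) i j :
  (forall i j, 0 <= u i j) -> u i j <= \sum_i \sum_j u i j.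
Proof.
move=> u0; rewrite (bigD1 i)//= (bigD1 j)//= -addrA lerDl addr_ge0//.
  by apply: sumr_ge0.
by apply: sumr_ge0 => k _; exact: sumr_ge0.
Qed.

Hypothesis ends_right :
  (forall x, exists2 t, I t & x < t) \/ (forall y, exists2 t, I t & y < f t).
Hypothesis ends_left :
  (forall x, exists2 t, I t & t < x) \/ (forall y, exists2 t, I t & f t < y).

(** Each entry is confined on both sides separately, and the finitely many bounds are merged by a
    maximum and a minimum. Openness of [I] supplies points of [I] on both sides of [s] and of every
    [p i j]. *)
Lemma confinement (m n : nat) (p : 'I_m -> 'I_n -> R) (s L : R) :
  I s -> (forall i j, I (p i j)) ->
  exists a b, [/\ I a, I b, a <= s <= b & forall i j t, I t ->
    (f t - f (p i j)) * (t - s) <= L -> a <= t <= b].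
Proof.
move=> Is Ip.
have right (ij : 'I_m * 'I_n) : exists b, I b /\ forall t, I t ->
    (f t - f (p ij.1 ij.2)) * (t - s) <= L -> t <= b.
  have [||b Ib Hb] := confined_right I f s (f (p ij.1 ij.2)) L f_lt ends_right.
  - exact: open_gt.
  - by have [u Iu pu] := open_gt oI _ (Ip ij.1 ij.2); exists u => //; exact: f_lt.
  - by exists b.
have left (ij : 'I_m * 'I_n) : exists b, I b /\ forall t, I t ->
    (f t - f (p ij.1 ij.2)) * (t - s) <= L -> b <= t.
  have [||b Ib Hb] := confined_left I f s (f (p ij.1 ij.2)) L f_lt ends_left.
  - exact: open_lt.
  - by have [u Iu pu] := open_lt oI _ (Ip ij.1 ij.2); exists u => //; exact: f_lt.
  - by exists b.
have [B HB] := choice right; have [A HA] := choice left.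
have [b [Ib sb Bb]] := finite_ubound _ B s Is (fun x => (HB x).1).
have [a [Ia sa Aa]] := finite_lbound _ A s Is (fun x => (HA x).1).
exists a, b; split => //; first by rewrite sa.
move=> i j t It Ht; apply/andP; split.
- by apply: le_trans (Aa (i, j)) _; exact: (HA (i, j)).2.
- by apply: le_trans (Bb (i, j)); exact: (HB (i, j)).2.
Qed.

(** Moving one coordinate of [al] or [be] shifts exactly one row or column of the sums, so
    [stationary] yields the corresponding margin. Local maximality suffices, which is what a
    maximiser over a box provides. *)
Lemma stationary_sums (m n : nat) (r : 'rV[R]_m) (c : 'rV[R]_n)
    (al : 'rV[R]_m) (be : 'rV[R]_n) (d : R) :
  0 < d -> (forall i j, I (al 0 i + be 0 j)) ->
  (forall (al' : 'rV[R]_m) (be' : 'rV[R]_n),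
     (forall i j, I (al' 0 i + be' 0 j)) ->
     (forall i j, `|al' 0 i + be' 0 j - (al 0 i + be 0 j)| < d) ->
     \sum_i r 0 i * al' 0 i + \sum_j c 0 j * be' 0 j
       - \sum_i \sum_j psi (al' 0 i + be' 0 j) <=
     \sum_i r 0 i * al 0 i + \sum_j c 0 j * be 0 j
       - \sum_i \sum_j psi (al 0 i + be 0 j)) ->
  (forall i, \sum_j f (al 0 i + be 0 j) = r 0 i) /\
  (forall j, \sum_i f (al 0 i + be 0 j) = c 0 j).
Proof.
move=> d0 Ith max; split.
- move=> i; apply/esym.
  apply: (stationary dpsi oI n (fun j => al 0 i + be 0 j) _ d d0 (Ith i)).
  move=> e ed Ie; pose al' := al + e *: delta_mx 0 i.
  have alE k : al' 0 k = al 0 k + (if k == i then e else 0).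
    by rewrite !mxE eqxx/=; case: eqP => _; rewrite ?mulr1 ?mulr0.
  have /max : forall k l, I (al' 0 k + be 0 l).
    move=> k l; rewrite alE addrAC; case: eqP => [->|_]; first exact: Ie.
    by rewrite addr0.
  have close k l : `|al' 0 k + be 0 l - (al 0 k + be 0 l)| < d.
    rewrite (_ : _ - _ = if k == i then e else 0); last by rewrite alE; ring.
    by case: ifP => //; rewrite normr0.
  move=> /(_ close); rewrite (bigD1 i)//= [\sum_i r 0 i * al 0 i](bigD1 i)//=.
  rewrite [X in _ - X <= _](bigD1 i)//= [X in _ <= _ - X](bigD1 i)//=.
  rewrite (eq_bigr (fun k => r 0 k * al 0 k)); last first.
    by move=> k /negbTE ki; rewrite alE ki addr0.
  rewrite [X in _ - (_ + X) <= _](eq_bigr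
    (fun k => \sum_j psi (al 0 k + be 0 j))); last first.
    by move=> k /negbTE ki; apply: eq_bigr => l _; rewrite alE ki addr0.
  rewrite sumrB alE eqxx.
  under [X in _ - (X + _) <= _]eq_bigr do rewrite addrAC.
  lra.
- move=> j; apply/esym.
  apply: (stationary dpsi oI m (fun i => al 0 i + be 0 j) _ d d0 (Ith^~ j)).
  move=> e ed Ie; pose be' := be + e *: delta_mx 0 j.
  have beE k : be' 0 k = be 0 k + (if k == j then e else 0).
    by rewrite !mxE eqxx/=; case: eqP => _; rewrite ?mulr1 ?mulr0.
  have /max : forall k l, I (al 0 k + be' 0 l).
    move=> k l; rewrite beE addrA; case: eqP => [->|_]; first exact: Ie.
    by rewrite addr0.
  have close k l : `|al 0 k + be' 0 l - (al 0 k + be 0 l)| < d.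
    rewrite (_ : _ - _ = if l == j then e else 0); last by rewrite beE; ring.
    by case: ifP => //; rewrite normr0.
  move=> /(_ close); rewrite [X in _ - X <= _]exchange_big/= [X in _ <= _ - X]exchange_big/=.
  rewrite [\sum_i c 0 i * be' 0 i](bigD1 j)//= [\sum_i c 0 i * be 0 i](bigD1 j)//=.
  rewrite [X in _ - X <= _](bigD1 j)//= [X in _ <= _ - X](bigD1 j)//=.
  rewrite [X in _ + (_ + X) - _ <= _](eq_bigr (fun k => c 0 k * be 0 k)); last first.
    by move=> k /negbTE ki; rewrite beE ki addr0.
  rewrite [X in _ - (_ + X) <= _](eq_bigr
    (fun k => \sum_i psi (al 0 i + be 0 k))); last first.
    by move=> k /negbTE ki; apply: eq_bigr => l _; rewrite beE ki addr0.
  rewrite sumrB beE eqxx.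
  under [X in _ - (X + _) <= _]eq_bigr do rewrite addrA.
  lra.
Qed.

(** Sum tables see only the margin of [z]; hence any table with the given margin can represent the
    linear part of the likelihood. *)
Lemma sum_pairing (m n : nat) (z : 'M[R]_(m, n)) (al : 'rV[R]_m) (be : 'rV[R]_n) :
  \sum_i \sum_j z i j * (al 0 i + be 0 j) =
  \sum_i (\sum_j z i j) * al 0 i + \sum_j (\sum_i z i j) * be 0 j.
Proof.
under [X in _ + X]eq_bigr do rewrite mulr_suml.
rewrite [X in _ + X]exchange_big/= -big_split/=; apply: eq_bigr => i _.
by rewrite mulr_suml -big_split/=; apply: eq_bigr => j _; rewrite mulrDr.
Qed.

Lemma critical_table (m n : nat) (z : 'M[R]_(m, n)) :
  I !=set0 -> (forall i j, exists2 p, I p & f p = z i j) ->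
  exists (al : 'rV[R]_m) (be : 'rV[R]_n),
    [/\ forall i j, I (al 0 i + be 0 j),
        forall i, \sum_j f (al 0 i + be 0 j) = \sum_j z i j &
        forall j, \sum_i f (al 0 i + be 0 j) = \sum_i z i j].
Proof.
(* Without rows or without columns all sums involved are empty. *)
case: m z => [z _ _|m].
  by exists 0, 0; split=> [[]//|[]//|j]; rewrite !big_ord0.
case: n => [z _ _|n z].
  by exists 0, 0; split=> [_ []//|i|[]//]; rewrite !big_ord0.
move=> [s Is] zI.
have {zI} [p Ip fp] : exists2 p : 'I_m.+1 -> 'I_n.+1 -> R,
    forall i j, I (p i j) & forall i j, f (p i j) = z i j.
  have [p Hp] := choice (fun ij : 'I_m.+1 * 'I_n.+1 =>
    let: ex_intro2 p Ip fp := zI ij.1 ij.2 in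
    ex_intro (fun p => I p /\ f p = z ij.1 ij.2) p (conj Ip fp)).
  by exists (fun i j => p (i, j)) => i j; have [] := Hp (i, j).
(* By [pairing_lbound] the term at [(i, j)] is at least [- K i j], so a nonpositive total bounds
   each single term by the sum of [K]. This bound, and hence [[A, B]], is fixed before the box is
   chosen. *)
pose K i j := `|f s - f (p i j)| * `|p i j - s|.
have K0 i j : 0 <= K i j by rewrite mulr_ge0.
have [A [B [IA IB sAB conf]]] := confinement _ _ p s (\sum_i \sum_j K i j) Is Ip.
(* The box is strictly larger than [[A, B]], so a maximiser confined to [[A, B]] has room to move in
   every direction. *)
have [a Ia aA] := open_lt oI _ IA; have [b Ib Bb] := open_gt oI _ IB.
have ab : a <= b by lra.
have [al [be [adm max]]] := box_maximizer _ _ z a b ab Ia Ib.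
have abI x : a <= x <= b -> I x by exact: itvI.
pose th i j := al 0 i + be 0 j.
have thAB i j : A <= th i j <= B.
  apply: (segment_limit A B s) => // e e01.
  (* The first-order inequality is read off at theta + e (s - theta), where the
     tangent inequality gives it without taking a derivative. *)
  pose te i j := th i j + e * (s - th i j).
  pose ale := (1 - e) *: al; pose bee := (1 - e) *: be + const_mx (e * s).
  have teE k l : ale 0 k + bee 0 l = te k l by rewrite !mxE /te /th; ring.
  have teab k l : a <= te k l <= b.
    by have := adm k l; rewrite /te -/(th k l); nra.
  have Ite k l : I (te k l) by exact/abI/teab.
  have Ith k l : I (th k l) by exact/abI/adm.
  have {max} := max ale bee; rewrite -subr_le0 -sumrB => le0.
  (* Since [te - s = (1 - e) * (th - s)], the positive factor [e / (1 - e)] turns [te - s] into the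
     displacement [th - te] of the tangent inequality at [te]. *)
  have {le0} : \sum_k \sum_l (f (te k l) - z k l) * (te k l - s) * (e / (1 - e)) <= 0.
    apply: le_trans (le0 _); last by move=> k l; rewrite teE.
    apply: ler_sum => k _; rewrite -sumrB; apply: ler_sum => l _.
    rewrite teE -/(th k l) -mulrA.
    have -> : (te k l - s) * (e / (1 - e)) = e * (th k l - s) by rewrite /te; field; lra.
    have := tangent_le itvI f_lt dpsi _ _ (Ith k l) (Ite k l).
    rewrite {3}/te.
    have -> : th k l - (th k l + e * (s - th k l)) = e * (th k l - s) by ring.
    have : te k l = th k l - e * (th k l - s) by rewrite /te; ring.
    nra.
  under eq_bigr do rewrite -mulr_suml.
  rewrite -mulr_suml pmulr_lle0 ?divr_gt0; [|lra..] => le0.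
  apply: (conf i j (te i j) (Ite i j)).
  (* Adding [K] makes all terms nonnegative, so a single one is at most their total. *)
  apply: (@le_trans _ _ ((f (te i j) - f (p i j)) * (te i j - s) + K i j)).
    by rewrite lerDl.
  apply: le_trans (term_le_sum _ _
    (fun i j => (f (te i j) - f (p i j)) * (te i j - s) + K i j) i j _) _.
    move=> k l; have := pairing_lbound s (p k l) (te k l) Is (Ip k l) (Ite k l).
    by rewrite /K; lra.
  under eq_bigr do rewrite big_split/=.
  rewrite big_split/=.
  under eq_bigr do under eq_bigr do rewrite fp.
  lra.
exists al, be; have Ith i j : I (al 0 i + be 0 j) by exact/abI/adm.
(* Sums within [d] of the maximiser remain in [[a, b]], where its maximality applies. *)
pose d := Num.min (A - a) (b - B).
have d0 : 0 < d by rewrite lt_min; lra.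
have [] := stationary_sums _ _ (\row_i \sum_j z i j) (\row_j \sum_i z i j)
  al be d d0 Ith; last first.
  by move=> rows cols; split=> // i; [rewrite rows mxE|rewrite cols mxE].
have gE (al' : 'rV[R]_m.+1) (be' : 'rV[R]_n.+1) :
    \sum_i (\row_i \sum_j z i j) 0 i * al' 0 i +
    \sum_j (\row_j \sum_i z i j) 0 j * be' 0 j -
    \sum_i \sum_j psi (al' 0 i + be' 0 j) =
    \sum_i \sum_j (z i j * (al' 0 i + be' 0 j) - psi (al' 0 i + be' 0 j)).
  under [in RHS]eq_bigr do rewrite sumrB.
  rewrite sumrB sum_pairing; congr (_ + _ - _);
    by apply: eq_bigr => i _; rewrite mxE.
move=> al' be' _ close; rewrite !gE; apply: max => i j.
by have := thAB i j; have := close i j; rewrite /th lt_min !ltr_norml; lra.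
Qed.

End table_critical_point.

(** * Differentiability of the Laplace transform *)

Section laplace_transform.
Context {R : realType}.
Variable mu : {measure set (measurableTypeR R) -> \bar R}.

Lemma measurable_expRM (t : R) :
  measurable_fun [set: measurableTypeR R] (fun x : R => expR (t * x)).
Proof. by apply: measurableT_comp => //; exact: mulrl_measurable. Qed.

Lemma laplace_ge0 t : (0 <= laplace mu t)%E.
Proof. by apply: integral_ge0 => x _; rewrite lee_fin expR_ge0. Qed.

Lemma laplace_fin t : Theta mu t -> laplace mu t \is a fin_num.
Proof. by move=> h; rewrite ge0_fin_numE ?laplace_ge0. Qed.

Lemma Theta_integrable t : Theta mu t ->
  mu.-integrable setT (fun x : R => (expR (t * x))%:E).
Proof.
move=> h; apply/integrableP; split.
  by apply/measurable_EFinP; exact: measurable_expRM.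
by under eq_integral do rewrite /= ger0_norm ?expR_ge0//.
Qed.

(** For [a <= t <= b], [expR (t * x)] is at most [expR (b * x)] if [x] is nonnegative and at most
    [expR (a * x)] otherwise, hence at most their sum. *)
Lemma Theta_interval : is_interval (Theta mu).
Proof.
move=> a b Ta Tb t /andP[at_ tb].
have : (laplace mu a + laplace mu b < +oo)%E by exact: lte_add_pinfty.
apply: le_lt_trans; rewrite /laplace -ge0_integralD//=; first last.
- by apply/measurable_EFinP; exact: measurable_expRM.
- by apply/measurable_EFinP; exact: measurable_expRM.
apply: ge0_le_integral => //=.
- by apply/measurable_EFinP; exact: measurable_expRM.
- by apply/measurable_EFinP; apply: measurable_funD; exact: measurable_expRM.
- move=> x _; rewrite -EFinD lee_fin; have [x0|x0] := leP 0 x.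
  + by apply: ler_wpDl; rewrite ?expR_ge0// ler_expR; nra.
  + by apply: ler_wpDr; rewrite ?expR_ge0// ler_expR; nra.
Qed.

(** A point [w] near [z] lies between the translates of [x] and [y] by [w - z], which are still in
    [A]. *)
Lemma interior_interval (A : set R) : is_interval A -> is_interval A°.
Proof.
move=> iA x y Ax Ay z /andP[xz zy].
have /nbhs_ballP[d /= d0 dA] : nbhs x A := Ax.
have /nbhs_ballP[e /= e0 eA] : nbhs y A := Ay.
apply/nbhs_ballP; exists (Num.min d e) => /=; first by rewrite lt_min d0.
move=> w; rewrite /ball/= lt_min => /andP[wd we].
apply: (iA (x + (w - z)) (y + (w - z))); last by lra.
- by apply: dA; rewrite /ball/= opprD addrA subrr sub0r opprB.
- by apply: eA; rewrite /ball/= opprD addrA subrr sub0r opprB.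
Qed.

Lemma interval_interior_mid (A : set R) x y z :
  is_interval A -> A x -> A y -> x < z < y -> A° z.
Proof.
move=> iA Ax Ay xzy; have : nbhs z `]x, y[%classic.
  by apply: open_nbhs_nbhs; split; [exact: interval_open|rewrite /= in_itv].
apply: filterS => w /=; rewrite in_itv/= => /andP[xw wy].
by apply: (iA x y) => //; rewrite !ltW.
Qed.

Lemma is_derive_expRM (t x : R) :
  is_derive t 1 (fun t : R => expR (t * x)) (x * expR (t * x)).
Proof.
have h : is_derive t 1 (fun t => t * x) x.
  have -> : (fun t => t * x) = x \*: id by apply/funext => u; rewrite /= mulrC.
  by apply: is_derive_eq; rewrite scaler1.
have := @is_derive1_comp _ expR (fun t => t * x) t _ _ (is_derive_expR _) h.
by rewrite mulrC.
Qed.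

Lemma partial1of2_expRM (t x : R) :
  partial1of2 (fun t x : R => expR (t * x)) t x = x * expR (t * x).
Proof. by rewrite partial1of2E; have [] := is_derive_expRM t x. Qed.

(** The factor [d * |x|] is absorbed by [expR (d * |x|)], which moves the exponent by at most
    another [d]. The right side is a majorant uniform in [t]. *)
Lemma abs_expR_le (a t d x : R) : 0 < d -> a - d <= t <= a + d ->
  `|x| * expR (t * x) <=
    d^-1 * (expR ((a - 2 * d) * x) + expR ((a + 2 * d) * x)).
Proof.
move=> d0 atd; rewrite ler_pdivlMl// mulrA.
have dx : d * `|x| <= expR (d * `|x|).
  by apply: le_trans (expR_ge1Dx _); rewrite lerDr.
apply: (@le_trans _ _ (expR (d * `|x|) * expR (t * x))).
  by rewrite ler_wpM2r// expR_ge0.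
rewrite -expRD; have [x0|x0] := leP 0 x.
- by apply: ler_wpDl; rewrite ?expR_ge0// ler_expR ger0_norm//; nra.
- by apply: ler_wpDr; rewrite ?expR_ge0// ler_expR ltr0_norm//; nra.
Qed.

Definition dlaplace t : R := \int[mu]_x (x * expR (t * x)).

(** Dominated differentiation under the integral sign. The integrability is recorded as well because
    it later identifies the mean of the tilted law. *)
Lemma laplace_derive t : (Theta mu)° t ->
  [/\ is_derive t 1 (fun s => fine (laplace mu s)) (dlaplace t) &
     mu.-integrable setT (fun x : R => (x * expR (t * x))%:E)].
Proof.
move=> /nbhs_ballP[e /= e0 eT].
(* With a quarter of the radius, both exponents [t - 2 * d] and [t + 2 * d] of the majorant stay in
   [Theta]. *)
pose d := e / 4.
have d0 : 0 < d by rewrite divr_gt0.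
have Tm s : t - 2 * d <= s <= t + 2 * d -> Theta mu s.
  by move=> h; apply: eT; rewrite /ball/= ltr_norml; move: h; rewrite /d; lra.
pose G x := d^-1 * (expR ((t - 2 * d) * x) + expR ((t + 2 * d) * x)).
have intG : mu.-integrable setT (EFin \o G).
  have -> : EFin \o G = (fun x => (d^-1)%:E *
      ((expR ((t - 2 * d) * x))%:E + (expR ((t + 2 * d) * x))%:E))%E.
    by apply/funext => x.
  by apply: integrableZl => //; apply: integrableD => //;
     apply: Theta_integrable; apply: Tm; lra.
have xint : mu.-integrable setT (fun x : R => (x * expR (t * x))%:E).
  apply: (le_integrable measurableT _ _ intG).
    apply/measurable_EFinP; apply: measurable_funM => //.
    exact: measurable_expRM.
  move=> x _; rewrite /= lee_fin normrM (ger0_norm (expR_ge0 _)).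
  by apply: le_trans (ler_norm _); apply: abs_expR_le => //; lra.
split=> //.
have Iin s : `]t - d, t + d[ s -> t - d <= s <= t + d.
  by rewrite /= in_itv/=; lra.
have C := @cvg_differentiation_under_integral R _ (measurableTypeR R) mu
  (fun t x : R => expR (t * x)) setT measurableT t (t - d) (t + d).
have H1 : `]t - d, t + d[%classic t by rewrite /= in_itv/=; lra.
have dx (s x : R) : derivable (fun t : R => expR (t * x)) s 1.
  by have [] := is_derive_expRM s x.
have {}C : h^-1 *: (fine (laplace mu (h + t)) - fine (laplace mu t)) @[h --> 0^'] -->
   dlaplace t.
  rewrite /dlaplace; under eq_Rintegral do rewrite -partial1of2_expRM.
  apply: (C H1 _ _ G) => //.
  - by move=> s Is; apply: Theta_integrable; apply: Tm; have := Iin _ Is; lra.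
  - by move=> x; rewrite /G mulr_ge0 ?invr_ge0 ?addr_ge0 ?expR_ge0// ltW.
  - move=> s x Is _; rewrite partial1of2_expRM normrM (ger0_norm (expR_ge0 _)).
    by apply: abs_expR_le => //; exact: Iin.
have E : (fun h => h^-1 *: (fine (laplace mu (h *: 1 + t)) - fine (laplace mu t))) =
   (fun h => h^-1 *: (fine (laplace mu (h + t)) - fine (laplace mu t))).
  by apply/funext => h; rewrite scaler1.
apply: DeriveDef.
  by apply/cvg_ex; exists (dlaplace t); rewrite E.
by rewrite /derive E; exact: cvg_lim C.
Qed.

End laplace_transform.

(** * Support and tilted laws *)

Section support.
Context {R : realType}.
Variable mu : {measure set (measurableTypeR R) -> \bar R}.

(** Every point outside the support lies in a null ball with rational centre and radius, and there
    are countably many of these. *)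
Lemma msupport_setC_negligible : mu.-negligible (~` msupport mu).
Proof.
(* [F] enumerates the rational balls; codes of no ball or of a ball of positive measure give the
   empty set. *)
pose F k : set (measurableTypeR R) :=
  if unpickle k is Some (c, r) then
    let B := ball (ratr c : R) (ratr r) in
    if mu B == 0%E then B else set0
  else set0.
have sub : ~` msupport mu `<=` \bigcup_k F k.
  move=> x /= /existsNP[U] /not_implyP[oU] /not_implyP[Ux].
  move=> /negP; rewrite -leNgt => mU.
  have [c [r /= [/set_mem xB BU]]] := open_subball_rat oU (mem_set Ux).
  have [k kE] : exists k, unpickle k = Some (c, r).
    by exists (pickle (c, r)); exact: pickleK.
  exists k => //; rewrite /F kE.
  have mB : measurable (ball (ratr c : R) (ratr r)).
    exact: measurable_ball.
  rewrite ifT//; apply/eqP/le_anti; rewrite measure_ge0 andbT.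
  apply: le_trans mU; apply: le_measure; rewrite ?inE//.
  exact: open_measurable.
apply: (@negligibleS _ (measurableTypeR R) _ mu _ _ sub); apply: negligible_bigcup => k; rewrite /F.
case: unpickle => [[c r]|]; last exact: negligible_set0.
case: eqP => [B0|_]; last exact: negligible_set0.
exists (ball (ratr c : R) (ratr r)); split => //.
exact: measurable_ball.
Qed.

(** On the support, hence almost everywhere, [expR (s * x)] is at most [expR C * expR (t * x)]. *)
Lemma Theta_shift (s t C : R) : Theta mu t ->
  (forall x, msupport mu x -> (s - t) * x <= C) -> Theta mu s.
Proof.
move=> Tt H; have : ((expR C)%:E * laplace mu t < +oo)%E.
  by rewrite -(fineK (laplace_fin _ _ Tt)) -EFinM ltry.
apply: le_lt_trans; rewrite /laplace -ge0_integralZl//=; last first.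
  by apply/measurable_EFinP; exact: measurable_expRM.
apply: ae_ge0_le_integral => //=.
- by apply/measurable_EFinP; exact: measurable_expRM.
- apply/measurable_EFinP; apply: measurable_funM => //; exact: measurable_expRM.
- apply: negligibleS msupport_setC_negligible => x /=; apply: contra_not => sx _.
  rewrite -EFinM lee_fin -expRD ler_expR.
  by have := H _ sx; lra.
Qed.

Lemma supp_sup_ub x : msupport mu x -> (x%:E <= supp_sup mu)%E.
Proof. by move=> sx; apply: ereal_sup_ubound; exists x. Qed.

Lemma supp_inf_lb x : msupport mu x -> (supp_inf mu <= x%:E)%E.
Proof. by move=> sx; apply: ereal_inf_lbound; exists x. Qed.

(** If the support is bounded above, [Theta_shift] puts everything to the right of [t0] in [Theta];
    otherwise the mean domain is unbounded above. This feeds the dichotomy of [confined_right]. *)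
Lemma Theta_right_end : Theta mu !=set0 -> mean_domain mu !=set0 ->
  (forall x, exists2 t, (Theta mu)° t & x < t) \/
  (forall y, exists2 z, mean_domain mu z & y < z).
Proof.
move=> [t0 Tt0] [z0 /andP[Az0 z0B]].
case E : (supp_sup mu) z0B => [b| |] // z0B.
- left => x; exists (Num.max x t0 + 1); last first.
    by rewrite (@le_lt_trans _ _ (Num.max x t0)) ?le_max ?lexx// ltrDl.
  have TT s : t0 <= s -> Theta mu s.
    move=> ts; apply: (Theta_shift s t0 ((s - t0) * b) Tt0) => y sy.
    by rewrite ler_wpM2l ?subr_ge0// -lee_fin -E supp_sup_ub.
  have mt : t0 <= Num.max x t0 by rewrite le_max lexx orbT.
  apply: (@interval_interior_mid R (Theta mu) t0 (Num.max x t0 + 2)).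
  + exact: Theta_interval.
  + exact: Tt0.
  + by apply: TT; lra.
  + by lra.
- right => y; exists (Num.max y z0 + 1); last first.
    by rewrite (@le_lt_trans _ _ (Num.max y z0)) ?le_max ?lexx// ltrDl.
  rewrite /mean_domain/= E ltry andbT (lt_trans Az0)// lte_fin.
  by rewrite (@le_lt_trans _ _ (Num.max y z0)) ?le_max ?lexx ?orbT// ltrDl.
Qed.

Lemma Theta_left_end : Theta mu !=set0 -> mean_domain mu !=set0 ->
  (forall x, exists2 t, (Theta mu)° t & t < x) \/
  (forall y, exists2 z, mean_domain mu z & z < y).
Proof.
move=> [t0 Tt0] [z0 /andP[Az0 z0B]].
case E : (supp_inf mu) Az0 => [a| |] // Az0.
- left => x; exists (Num.min x t0 - 1); last first.
    by rewrite (@lt_le_trans _ _ (Num.min x t0)) ?ge_min ?lexx// gtrDl oppr_lt0.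
  have TT s : s <= t0 -> Theta mu s.
    move=> ts; apply: (Theta_shift s t0 ((s - t0) * a) Tt0) => y sy.
    by rewrite ler_wnM2l ?subr_le0// -lee_fin -E supp_inf_lb.
  have mt : Num.min x t0 <= t0 by rewrite ge_min lexx orbT.
  apply: (@interval_interior_mid R (Theta mu) (Num.min x t0 - 2) t0).
  + exact: Theta_interval.
  + by apply: TT; lra.
  + exact: Tt0.
  + by lra.
- right => y; exists (Num.min y z0 - 1); last first.
    by rewrite (@lt_le_trans _ _ (Num.min y z0)) ?ge_min ?lexx// gtrDl oppr_lt0.
  rewrite /mean_domain/= E ltNyr/= (lt_trans _ z0B)// lte_fin.
  by rewrite (@lt_le_trans _ _ (Num.min y z0)) ?ge_min ?lexx ?orbT// gtrDl oppr_lt0.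
Qed.

End support.

(** Normalisation divides by the total mass, here [1]; the Dirac law is only its fallback for a
    total mass of zero or infinity. *)
Lemma unit_mass_probability (R : realType) d (T : measurableType d)
    (M : {measure set T -> \bar R}) : M setT = 1%E ->
  exists P : probability T R, forall A, P A = M A.
Proof.
move=> M1; exists (mnormalize M (dirac point)) => A /=.
by rewrite /mnormalize M1 onee_eq0/= invr1 mule1.
Qed.

(** * Densities, the derivative of [psi], and the mean of a tilted law *)

Section tilted_law.
Context {R : realType}.
Variable mu : {sigma_finite_measure set (measurableTypeR R) -> \bar R}.

(** [P] is dominated by the sigma-finite [mu]; its Radon-Nikodym derivative has the same integrals
    as [g] over measurable sets, so the two agree almost everywhere. *)
Lemma ge0_integral_density (P : probability (measurableTypeR R) R)
    (g : R -> R) (f : measurableTypeR R -> \bar R) :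
  measurable_fun setT g -> (forall x, 0 <= g x) ->
  (forall A, measurable A -> P A = (\int[mu]_(x in A) (g x)%:E)%E) ->
  measurable_fun setT f -> (forall x, 0 <= f x)%E ->
  (\int[P]_x f x = \int[mu]_x (f x * (g x)%:E))%E.
Proof.
move=> mg g0 Pg mf f0.
have dom : P `<< mu.
  apply/null_content_dominatesP => A mA muA0; rewrite Pg//.
  by apply: null_set_integral => //; apply/measurable_EFinP; exact: measurable_funTS.
have intg : mu.-integrable setT (fun x => (g x)%:E).
  apply/integrableP; split; first exact/measurable_EFinP.
  under eq_integral do rewrite /= ger0_norm//.
  by rewrite -Pg// (le_lt_trans (probability_le1 P measurableT))// ltry.
rewrite -(Radon_Nikodym_SigmaFinite.change_of_variables dom f0 measurableT mf).
apply: ae_eq_integral => //.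
- apply: emeasurable_funM => //.
  exact: measurable_int (Radon_Nikodym_SigmaFinite.f_integrable dom).
- by apply: emeasurable_funM => //; exact/measurable_EFinP.
- apply: ae_eqe_mul2l; apply: integral_ae_eq => //.
  + exact: Radon_Nikodym_SigmaFinite.f_integrable.
  + exact/measurable_EFinP.
  + move=> A _ mA.
    by rewrite -Pg// -Radon_Nikodym_SigmaFinite.f_integral.
Qed.

Lemma integral_density (P : probability (measurableTypeR R) R)
    (g f : R -> R) :
  measurable_fun setT g -> (forall x, 0 <= g x) ->
  (forall A, measurable A -> P A = (\int[mu]_(x in A) (g x)%:E)%E) ->
  measurable_fun setT (f : measurableTypeR R -> R) ->
  (\int[P]_x (f x)%:E = \int[mu]_x (f x * g x)%:E)%E.
Proof.
move=> mg g0 Pg mf; rewrite integralE [RHS]integralE.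
have mEf : measurable_fun setT (EFin \o (f : measurableTypeR R -> R)) by exact/measurable_EFinP.
congr (_ - _)%E.
- rewrite (ge0_integral_density P g _ mg g0 Pg)//; last exact: measurable_funepos.
  apply: eq_integral => x _.
  by rewrite !funeposE -!EFin_max -EFinM maxr_pMl// mul0r.
- rewrite (ge0_integral_density P g _ mg g0 Pg)//; last exact: measurable_funeneg.
  apply: eq_integral => x _.
  by rewrite !funenegE -!EFinN -!EFin_max -EFinM maxr_pMl// mul0r mulNr.
Qed.

Hypothesis psi2_gt0 : forall t, (Theta mu)° t -> 0 < (psi mu)^`(2) t.

(** A vanishing integral of a positive function makes [mu] null; then [psi] is constant, against the
    positive second derivative. *)
Lemma laplace_gt0 t : (Theta mu)° t -> 0 < fine (laplace mu t).
Proof.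
move=> Tt; rewrite lt_neqAle fine_ge0 ?laplace_ge0// andbT eq_sym.
apply/negP => /eqP l0.
have T := interior_subset Tt.
have L0 : laplace mu t = 0%E by rewrite -(fineK (laplace_fin mu t T)) l0.
have me s : measurable_fun setT (fun x : measurableTypeR R => (expR (s * x))%:E).
  by apply/measurable_EFinP; exact: measurable_expRM.
have muT : mu setT = 0%E.
  have /(ae_eq_integral_abs mu measurableT (me t)) :
      (\int[mu]_x `|(expR (t * x))%:E|)%E = 0%E.
    by under eq_integral do rewrite /= ger0_norm ?expR_ge0//.
  move=> [N [mN N0 sub]].
  suff <- : N = setT by [].
  apply/seteqP; split => // x _; apply: sub => /= /(_ Logic.I)[].
  by apply/eqP; rewrite gt_eqF// expR_gt0.
have psiE : psi mu = cst (ln 0).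
  by apply/funext => s; rewrite /psi /laplace (null_set_integral measurableT (me s) muT).
have d0 (k : R) : (cst k)^`() = cst 0 :> (R -> R).
  by apply/funext => s; rewrite derive1_cst.
by have := psi2_gt0 _ Tt; rewrite psiE derive1nS derive1n1 !d0 ltxx.
Qed.

Lemma tiltE t x : (Theta mu)° t ->
  expR (t * x - psi mu t) = expR (t * x) / fine (laplace mu t).
Proof. by move=> Tt; rewrite expRB /psi lnK// posrE laplace_gt0. Qed.

Lemma psi_derive t : (Theta mu)° t ->
  is_derive t 1 (psi mu) (dlaplace mu t / fine (laplace mu t)).
Proof.
move=> Tt; have [dl _] := laplace_derive mu t Tt.
have := @is_derive1_comp _ (@ln R) (fun s => fine (laplace mu s)) t _ _
  (is_derive1_ln (laplace_gt0 _ Tt)) dl.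
by rewrite mulrC.
Qed.

Lemma is_derive_psi t : (Theta mu)° t -> is_derive t 1 (psi mu) ((psi mu)^`() t).
Proof.
by move=> Tt; have [d E] := psi_derive t Tt; apply: DeriveDef; rewrite ?derive1E.
Qed.

Lemma dpsi_lt x y : (Theta mu)° x -> (Theta mu)° y -> x < y ->
  (psi mu)^`() x < (psi mu)^`() y.
Proof.
move=> Tx Ty xy.
have T z : z \in `[x, y]%R -> (Theta mu)° z.
  rewrite in_itv/=; apply: (@interior_interval _ (Theta mu)) => //.
  exact: Theta_interval.
have d z : z \in `[x, y]%R -> derivable ((psi mu)^`()) z 1.
  (* A derivative that does not exist has the default value [0], so positivity of the second
     derivative forces differentiability. *)
  move=> /T Tz; apply: contrapT => nd.
  have := psi2_gt0 _ Tz; rewrite derive1nS derive1n1 derive1E.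
  by rewrite /derive dvgP ?ltxx.
apply: (@gtr0_derive1_lt_cc _ _ x y) => //.
- by move=> z /subset_itv_oo_cc; exact: d.
- by move=> z /subset_itv_oo_cc /T /psi2_gt0.
- exact: derivable_within_continuous.
- by rewrite in_itv/= lexx ltW.
- by rewrite in_itv/= lexx ltW.
Qed.

(** The mean of the tilted law is [dlaplace] divided by the Laplace transform, which is the
    logarithmic derivative computed in [psi_derive]. *)
Lemma tilt_probability t : (Theta mu)° t ->
  exists P : probability (measurableTypeR R) R,
    (forall A, P A = tilt mu t A) /\
    (\int[P]_x x%:E = ((psi mu)^`()%classic t)%:E)%E.
Proof.
move=> Tt; have T := interior_subset Tt; have L0 := laplace_gt0 _ Tt.
pose g x := expR (t * x - psi mu t).
have gE : g = fun x => (fine (laplace mu t))^-1 * expR (t * x).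
  by apply/funext => x; rewrite /g tiltE// mulrC.
have mg : measurable_fun setT (g : measurableTypeR R -> R).
  by rewrite gE; apply: measurable_funM => //; exact: measurable_expRM.
have g0 x : 0 <= g x by exact: expR_ge0.
pose M := tilt mu t : set (measurableTypeR R) -> \bar R.
have M0 : M set0 = 0%E by rewrite /M /tilt integral_set0.
have Mge A : (0 <= M A)%E by apply: integral_ge0 => x _; rewrite lee_fin expR_ge0.
have Msig : semi_sigma_additive M.
  apply: semi_sigma_additive_nng_induced; last by move=> x; rewrite lee_fin expR_ge0.
  exact/measurable_EFinP.
have M1 : M setT = 1%E.
  rewrite /M /tilt.
  under eq_integral do rewrite -/(g _) gE EFinM.
  rewrite integralZl//; last exact: Theta_integrable.
  by rewrite -/(laplace mu t) -(fineK (laplace_fin _ _ T)) -EFinM mulVf// gt_eqF.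
pose mM := isMeasure.Build _ _ _ M M0 Mge Msig.
pose MM : {measure set (measurableTypeR R) -> \bar R} := HB.pack M mM.
have [P PE] := unit_mass_probability _ _ _ MM M1.
exists P; split => //.
rewrite (integral_density P g id)//.
have [_ xint] := laplace_derive mu t Tt.
under eq_integral => x _ do rewrite gE mulrCA EFinM.
rewrite integralZl//.
have [_ E] := psi_derive t Tt; rewrite derive1E E EFinM [RHS]muleC; congr (_ * _)%E.
by rewrite /dlaplace /Rintegral fineK// integrable_fin_num.
Qed.

End tilted_law.

(** * Product laws *)

Section product_law_existence.
Context {R : realType}.

(** One factor is adjoined to the product space at a time. As the indices are distinct, giving the
    new index its own coordinate leaves the earlier variables untouched. *)
Lemma independent_family (K : eqType)
    (nu : K -> probability (measurableTypeR R) R) (s : seq K) : uniq s ->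
  exists d (T : measurableType d) (P : probability T R)
    (X : K -> T -> measurableTypeR R),
    (forall k, measurable_fun setT (X k)) /\
    forall S : K -> set (measurableTypeR R), (forall k, measurable (S k)) ->
      measurable [set w | forall k, k \in s -> S k (X k w)] /\
      P [set w | forall k, k \in s -> S k (X k w)] =
        (\prod_(k <- s) nu k (S k))%E.
Proof.
elim: s => [_|k s IH /= /andP[ks us]].
  exists _, (measurableTypeR R), (dirac (0 : measurableTypeR R)), (fun=> id); split => // S mS.
  have -> : [set w : measurableTypeR R | forall k : K, k \in [::] -> S k w] = setT.
    by apply/seteqP; split.
  by rewrite big_nil probability_setT.
have [d [T [P [X [mX PX]]]]] := IH us.
have M1 : (P \x nu k)%E setT = 1%E.
  by rewrite -setXTT product_measure1E//= !probability_setT mule1.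
have [Q QE] := unit_mass_probability _ _ _ (P \x nu k)%E M1.
exists _, (T * measurableTypeR R)%type, Q,
  (fun l w => if l == k then w.2 else X l w.1); split.
  move=> l; case: eqP => _; first exact: measurable_snd.
  exact: measurableT_comp.
move=> S mS; have [mA PA] := PX _ mS.
have -> : [set w : T * measurableTypeR R | forall l, l \in k :: s ->
      S l (if l == k then w.2 else X l w.1)] =
    [set w | forall l, l \in s -> S l (X l w)] `*` S k.
  apply/seteqP; split => [[w y] /= H|[w y] /= [H Hk] l].
    split; last by have := H k; rewrite mem_head eqxx; exact.
    move=> l ls; have := H l; rewrite inE ls orbT.
    by case: eqP => [lk|_]; [rewrite -lk ls in ks|exact].
  by rewrite inE; case: eqP => [->|_ /=]; [|exact: H].
split; first exact: measurableX.
apply: etrans (QE _) _; apply: etrans (product_measure1E _ _ mA (mS k)) _.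
by rewrite big_cons muleC; congr (_ * _)%E; exact: PA.
Qed.

Context {m n : nat}.

Lemma measurable_mx_entry i j :
  measurable_fun setT (fun Z : @mx_measurable R m n => Z i j : measurableTypeR R).
Proof.
move=> _ S mS; rewrite setTI; apply: sub_sigma_algebra.
by exists i, j, S.
Qed.

(** The product law is the distribution of a random matrix with independent entries. *)
Lemma product_law_exists (nu : 'I_m -> 'I_n -> probability (measurableTypeR R) R) :
  exists P : probability (@mx_measurable R m n) R,
    is_product_law (fun i j => nu i j) P.
Proof.
have [d [T [P [X [mX PX]]]]] := independent_family _
  (fun ij : 'I_m * 'I_n => nu ij.1 ij.2) _ (index_enum_uniq ('I_m * 'I_n)%type).
pose F w : @mx_measurable R m n := \matrix_(i, j) X (i, j) w.
have mF : measurable_fun setT F.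
  apply: (@measurability _ _ T (g_sigma_algebraType (@mx_cylinders R m n)) setT
    F (@mx_cylinders R m n)).
    by [].
  move=> _ [_ [i [j [S mS ->]]] <-].
  have -> : F @^-1` [set Z : 'M[R]_(m, n) | S (Z i j)] = X (i, j) @^-1` S.
    by apply/seteqP; split => w /=; rewrite mxE.
  exact: mX.
pose mixF := isMeasurableFun.Build _ _ _ _ F mF.
pose F' : {mfun T >-> @mx_measurable R m n} := HB.pack F mixF.
exists (distribution P F') => S mS.
rewrite pair_big /=; have [_ <-] := PX (fun ij => S ij.1 ij.2) (fun ij => mS ij.1 ij.2).
congr (P _); apply/seteqP; split => w /= H.
  by move=> [i j] _; have := H i j; rewrite mxE.
by move=> i j; rewrite mxE; exact: (H (i, j) (mem_index_enum _)).
Qed.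

(** A box whose sides are full except at [(i, j)] shows that the marginal of that entry is [nu i j];
    the expectation is then a change of variables. *)
Lemma product_law_expectation (nu : 'I_m -> 'I_n -> probability (measurableTypeR R) R)
    (P : probability (@mx_measurable R m n) R) i j :
  is_product_law (fun i j => nu i j) P ->
  ('E_P[fun Z : 'M[R]_(m, n) => Z i j] = \int[nu i j]_x x%:E)%E.
Proof.
move=> PP; rewrite unlock.
pose mixF := isMeasurableFun.Build _ _ _ _ _ (measurable_mx_entry i j).
pose F : {mfun @mx_measurable R m n >-> measurableTypeR R} :=
  HB.pack (fun Z : @mx_measurable R m n => Z i j : measurableTypeR R) mixF.
have PF A : measurable A -> distribution P F A = nu i j A.
  move=> mA.
  have mS k l : measurable (if (k == i) && (l == j) then A else setT).
    by case: ifP.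
  transitivity (P [set Z : 'M[R]_(m, n) | forall k l,
      (if (k == i) && (l == j) then A else setT) (Z k l)]).
    congr (P _); apply/seteqP; split => Z /=.
      by move=> AZ k l; case: ifP => // /andP[/eqP-> /eqP->].
    by move=> /(_ i j); rewrite !eqxx.
  rewrite (PP _ mS) (bigD1 i)//= (bigD1 j)//= !eqxx big1 ?mule1; last first.
    by move=> l /negbTE ->; exact: probability_setT.
  rewrite big1 ?mule1// => k /negbTE ki; rewrite big1// => l _.
  by rewrite ki probability_setT.
have -> : (\int[nu i j]_x x%:E = \int[distribution P F]_x x%:E)%E.
  by apply: eq_measure_integral => A mA _; exact/esym/PF.
have mE : measurable_fun setT (EFin : measurableTypeR R -> \bar R) by exact/measurable_EFinP.
rewrite integralE [RHS]integralE; congr (_ - _)%E.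
- rewrite ge0_integral_distribution//; last exact: (measurable_funepos mE).
  by apply: eq_integral => Z _; rewrite /= !funeposE.
- rewrite ge0_integral_distribution//; last exact: (measurable_funeneg mE).
  by apply: eq_integral => Z _; rewrite /= !funenegE.
Qed.

End product_law_existence.

(** * Duality *)

Section duality.
Context {R : realType}.
Variable mu : {sigma_finite_measure set (measurableTypeR R) -> \bar R}.
Hypothesis Theta_nontrivial : exists t1 t2, [/\ Theta mu t1, Theta mu t2 & t1 <> t2].
Hypothesis psi2_gt0 : forall t, (Theta mu)° t -> 0 < (psi mu)^`(2) t.
Hypothesis dpsi_bij : set_bij (Theta mu)° (mean_domain mu) ((psi mu)^`()).

Local Opaque psi.

Local Notation I := (Theta mu)°.
Local Notation f := (psi mu)^`().

Lemma Theta_interior_interval : is_interval I.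
Proof. by apply: interior_interval; exact: Theta_interval. Qed.

Lemma psi_conjugate_le x y : I x -> I y ->
  f y * x - psi mu x <= f y * y - psi mu y.
Proof.
exact: (conjugate_le Theta_interior_interval (dpsi_lt mu psi2_gt0)
  (is_derive_psi mu psi2_gt0)).
Qed.

Lemma Theta_interior_nonempty : I !=set0.
Proof.
have [t1 [t2 [T1 T2 t12]]] := Theta_nontrivial.
have mid u v : Theta mu u -> Theta mu v -> u < v -> I !=set0.
  move=> Tu Tv uv; exists ((u + v) / 2).
  by apply: (interval_interior_mid (Theta mu) u v _ (@Theta_interval _ mu) Tu Tv); lra.
have [lt|lt|//] := ltgtP t1 t2; [exact: (mid t1 t2)|exact: (mid t2 t1)].
Qed.

Lemma mean_domain_dpsi t : I t -> mean_domain mu (f t).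
Proof. by have [h _ _] := dpsi_bij; exact: h. Qed.

Lemma mean_domainP z : mean_domain mu z -> exists2 t, I t & f t = z.
Proof. by have [_ _ h] := dpsi_bij => /h[t]; exists t. Qed.

Lemma rel_entropy_dpsi t : I t ->
  rel_entropy mu (f t) = (f t * t - psi mu t)%:E.
Proof.
move=> It; rewrite /rel_entropy; have /= -> := mean_domain_dpsi _ It.
by have [_ h _] := dpsi_bij; rewrite /phi (pinvKV _ h)// inE.
Qed.

(** On the mean domain, where [z] is a value of the derivative, this is [psi_conjugate_le];
    elsewhere the right side is [+oo]. *)
Lemma fenchel_young z t : I t -> ((z * t - psi mu t)%:E <= rel_entropy mu z)%E.
Proof.
move=> It; have [/mean_domainP[p Ip <-]|nz] := pselect (mean_domain mu z).
  by rewrite (rel_entropy_dpsi _ Ip) lee_fin; exact: psi_conjugate_le.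
by rewrite /rel_entropy ifF ?leey//; apply/negbTE/negP.
Qed.

Lemma fenchel_young_eq z t : I t ->
  (rel_entropy mu z <= (z * t - psi mu t)%:E)%E -> z = f t.
Proof.
move=> It; have [/mean_domainP[p Ip <-]|nz] := pselect (mean_domain mu z); last first.
  by rewrite /rel_entropy ifF ?leye_eq//; apply/negbTE/negP.
rewrite (rel_entropy_dpsi _ Ip) lee_fin.
have [->//|tp] := eqVneq t p; rewrite leNgt => /negP[].
exact: (conjugate_lt Theta_interior_interval (dpsi_lt mu psi2_gt0)
  (is_derive_psi mu psi2_gt0)).
Qed.

Lemma rel_entropy_gtNy z : rel_entropy mu z != -oo%E.
Proof.
have [t It] := Theta_interior_nonempty.
by rewrite -ltNye (lt_le_trans _ (fenchel_young z t It))// ltNyr.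
Qed.

Context {m n : nat}.

(** No entry contributes [-oo], so a single entry outside the mean domain makes the whole sum
    [+oo]. *)
Lemma table_entropy_lty (Z : 'M[R]_(m, n)) : (table_entropy mu Z < +oo)%E ->
  forall i j, mean_domain mu (Z i j).
Proof.
move=> H i j; apply: contrapT => nz; move: H; apply/negP; rewrite -leNgt leye_eq.
have row k : (\sum_j rel_entropy mu (Z k j))%E != -oo%E.
  by apply/eqP => /esum_eqNyP[l [_ _ /eqP]]; rewrite (negbTE (rel_entropy_gtNy _)).
apply/eqP/esum_eqyP => //; exists i; split; rewrite ?mem_index_enum//.
apply/esum_eqyP => [l _|]; first exact: rel_entropy_gtNy.
exists j; split; rewrite ?mem_index_enum//.
by rewrite /rel_entropy ifF//; apply/negbTE/negP.
Qed.

Variables (r : 'rV[R]_m) (c : 'rV[R]_n).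

Lemma loglik_sum (a : 'rV[R]_m) (b : 'rV[R]_n) :
  loglik mu r c a b = \sum_i r 0 i * a 0 i + \sum_j c 0 j * b 0 j
    - \sum_i \sum_j psi mu (a 0 i + b 0 j).
Proof.
rewrite /loglik; apply: (congr1 (fun x => _ - x)).
by apply: eq_bigr => i _; apply: eq_bigr => j _; rewrite mxE.
Qed.

Lemma loglik_table (Z : 'M[R]_(m, n)) a b : margin_tables r c Z ->
  loglik mu r c a b =
  \sum_i \sum_j (Z i j * (a 0 i + b 0 j) - psi mu (a 0 i + b 0 j)).
Proof.
move=> [rows cols]; rewrite loglik_sum.
under [in RHS]eq_bigr do rewrite sumrB.
rewrite sumrB sum_pairing.
under [X in _ = X + _ - _]eq_bigr do rewrite rows.
by under [X in _ = _ + X - _]eq_bigr do rewrite cols.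
Qed.

Lemma admissibleE (a : 'rV[R]_m) (b : 'rV[R]_n) :
  admissible mu a b <-> forall i j, I (a 0 i + b 0 j).
Proof. by split=> h i j; have := h i j; rewrite mxE. Qed.

Lemma weak_duality (Z : 'M[R]_(m, n)) a b : margin_tables r c Z -> admissible mu a b ->
  ((loglik mu r c a b)%:E <= table_entropy mu Z)%E.
Proof.
move=> TZ /admissibleE ab; rewrite (loglik_table _ _ _ TZ) -sumEFin.
by apply: lee_sum => i _; rewrite -sumEFin; apply: lee_sum => j _; exact: fenchel_young.
Qed.

Lemma mean_tableE (a : 'rV[R]_m) (b : 'rV[R]_n) i j :
  mean_table mu a b i j = f (a 0 i + b 0 j).
Proof. by rewrite !mxE. Qed.

Lemma table_entropy_mean a b : margin_tables r c (mean_table mu a b) ->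
  admissible mu a b -> table_entropy mu (mean_table mu a b) = (loglik mu r c a b)%:E.
Proof.
move=> TM /admissibleE ab; rewrite (loglik_table _ _ _ TM) -sumEFin.
apply: eq_bigr => i _; rewrite -sumEFin; apply: eq_bigr => j _.
by rewrite mean_tableE rel_entropy_dpsi.
Qed.

(** The duality gap is a sum of Fenchel-Young gaps, all nonnegative; if the total is at most [0], so
    is each of them, and [fenchel_young_eq] identifies every entry. *)
Lemma strong_duality_eq (Z : 'M[R]_(m, n)) a b :
  margin_tables r c Z -> admissible mu a b ->
  (table_entropy mu Z <= (loglik mu r c a b)%:E)%E -> Z = mean_table mu a b.
Proof.
move=> TZ /admissibleE ab; rewrite (loglik_table _ _ _ TZ) => le.
have ZD := table_entropy_lty Z (le_lt_trans le (ltry _)).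
have [h hE] : exists h, forall i j, rel_entropy mu (Z i j) = (h i j)%:E.
  exists (fun i j => fine (rel_entropy mu (Z i j))) => i j.
  by rewrite /rel_entropy; have /= -> := ZD i j.
move: le; rewrite /table_entropy.
under eq_bigr do under eq_bigr do rewrite hE.
under eq_bigr do rewrite sumEFin.
rewrite sumEFin lee_fin -subr_le0 -sumrB => le.
have {}le : \sum_i \sum_j (h i j -
    (Z i j * (a 0 i + b 0 j) - psi mu (a 0 i + b 0 j))) <= 0.
  apply: le_trans le; rewrite le_eqVlt; apply/orP; left.
  by apply/eqP/eq_bigr => i _; rewrite -sumrB.
apply/matrixP => i j; rewrite mean_tableE.
apply: fenchel_young_eq => //; rewrite hE lee_fin -subr_le0.
apply: le_trans le.
apply: (term_le_sum _ _ (fun i j => h i j -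
    (Z i j * (a 0 i + b 0 j) - psi mu (a 0 i + b 0 j)))) => k l.
by have := fenchel_young (Z k l) _ (ab k l); rewrite hE lee_fin subr_ge0.
Qed.

(** The margin conditions are the first-order conditions. Conversely, with the mean table as
    representative of the margin, each entry of the likelihood is maximised separately. *)
Lemma MLE_mean_table a b : admissible mu a b ->
  is_MLE mu r c a b <-> margin_tables r c (mean_table mu a b).
Proof.
move=> ab; have /admissibleE Iab := ab; split=> [[_ max]|TM].
(* An MLE is a global maximiser, so the radius [1] is arbitrary. *)
- have [] := stationary_sums _ f (psi mu) (is_derive_psi mu psi2_gt0)
    (open_interior _) m n r c a b 1 ltr01 Iab.
    by move=> a' b' Iab' _; rewrite -!loglik_sum; exact/max/admissibleE.
  move=> rows cols; split=> [i|j].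
  + by rewrite -rows; apply: eq_bigr => j _; rewrite mean_tableE.
  + by rewrite -cols; apply: eq_bigr => i _; rewrite mean_tableE.
- split; [exact: ab|move=> a' b' /admissibleE Iab'].
  rewrite !(loglik_table _ _ _ TM); apply: ler_sum => i _; apply: ler_sum => j _.
  by rewrite mean_tableE; exact: psi_conjugate_le.
Qed.

Lemma MLE_exists (Z : 'M[R]_(m, n)) : margin_tables r c Z ->
  (forall i j, mean_domain mu (Z i j)) -> exists a b, is_MLE mu r c a b.
Proof.
move=> TZ ZD.
have [t0 It0] := Theta_interior_nonempty.
have T0 : Theta mu !=set0 by exists t0; exact: interior_subset It0.
have D0 : mean_domain mu !=set0 by exists (f t0); exact: mean_domain_dpsi.
(* Surjectivity onto the mean domain turns its unboundedness into that of the derivative of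
   [psi]. *)
have right : (forall x, exists2 t, I t & x < t) \/ (forall y, exists2 t, I t & y < f t).
  have [?|H] := Theta_right_end mu T0 D0; [by left|right => y].
  by have [z /mean_domainP[t It <-] yz] := H y; exists t.
have left : (forall x, exists2 t, I t & t < x) \/ (forall y, exists2 t, I t & f t < y).
  have [?|H] := Theta_left_end mu T0 D0; [by left|right => y].
  by have [z /mean_domainP[t It <-] yz] := H y; exists t.
have [a [b [Iab rows cols]]] := critical_table I f (psi mu) Theta_interior_interval
  (dpsi_lt mu psi2_gt0) (is_derive_psi mu psi2_gt0) (open_interior _) right left
  m n Z Theta_interior_nonempty (fun i j => mean_domainP _ (ZD i j)).
have ab : admissible mu a b by apply/admissibleE.
have [TZr TZc] := TZ; exists a, b; apply/MLE_mean_table => //; split=> [i|j].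
- by rewrite -TZr -rows; apply: eq_bigr => j _; rewrite mean_tableE.
- by rewrite -TZc -cols; apply: eq_bigr => i _; rewrite mean_tableE.
Qed.

(** The entropy of the mean table equals the likelihood at [(a, b)], which by weak duality bounds
    every other entropy from below. *)
Lemma typical_mean_table a b : admissible mu a b ->
  margin_tables r c (mean_table mu a b) -> is_typical_table mu r c (mean_table mu a b).
Proof.
move=> ab TM; split; [exact: TM| |move=> Z TZ].
  by rewrite (table_entropy_mean _ _ TM ab) ltry.
by rewrite (table_entropy_mean _ _ TM ab); exact: weak_duality.
Qed.

Lemma typical_of_MLE a b : is_MLE mu r c a b ->
  is_typical_table mu r c (mean_table mu a b).
Proof.
move=> M; have [ab _] := M; apply: typical_mean_table; first exact: ab.
exact: (MLE_mean_table a b ab).1 M.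
Qed.

Lemma typical_mean_domain (Z : 'M[R]_(m, n)) : is_typical_table mu r c Z ->
  forall i j, mean_domain mu (Z i j).
Proof. by move=> [_ H _]; exact: table_entropy_lty H. Qed.

Lemma MLE_of_typical (Z : 'M[R]_(m, n)) : is_typical_table mu r c Z ->
  exists a b, is_MLE mu r c a b.
Proof.
move=> tZ; have [TZ _ _] := tZ.
exact: (MLE_exists Z TZ (typical_mean_domain Z tZ)).
Qed.

Lemma typical_eq_mean_table (Z : 'M[R]_(m, n)) a b : is_typical_table mu r c Z ->
  admissible mu a b -> margin_tables r c (mean_table mu a b) -> Z = mean_table mu a b.
Proof.
move=> [TZ _ min] ab TM; apply: (strong_duality_eq Z a b TZ ab).
by rewrite -(table_entropy_mean a b TM ab); exact: min.
Qed.

Lemma strong_duality (Z : 'M[R]_(m, n)) : is_typical_table mu r c Z ->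
  ereal_inf (table_entropy mu @` (margin_tables r c : set 'M[R]_(m, n))) =
  ereal_sup [set x | exists a b,
    admissible mu a b /\ x = (loglik mu r c a b)%:E].
Proof.
move=> tZ; have [TZ _ min] := tZ; have [a [b M]] := MLE_of_typical Z tZ.
have [ab maxab] := M; have [TM _ _] := typical_of_MLE a b M.
have HZ : table_entropy mu Z = (loglik mu r c a b)%:E.
  by rewrite (typical_eq_mean_table Z a b tZ ab TM); exact: table_entropy_mean.
(* Both extrema are attained, at [Z] and at the MLE, with this common value. *)
transitivity (loglik mu r c a b)%:E.
  apply/le_anti/andP; split.
    by rewrite -HZ; apply: ereal_inf_lbound; exists Z.
  by apply: le_ereal_inf_tmp => _ [Z' TZ' <-]; exact: weak_duality.
apply/le_anti/andP; split.
  by apply: ereal_sup_ubound; exists a, b.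
by apply: ge_ereal_sup => _ [a' [b' [ab' ->]]]; rewrite lee_fin; exact: maxab.
Qed.

Lemma mean_table_product_law (a : 'rV[R]_m) (b : 'rV[R]_n) : admissible mu a b ->
  exists P : probability (@mx_measurable R m n) R,
    is_product_law (fun i j => tilt mu (oplus a b i j)) P /\
    has_mean_matrix P (mean_table mu a b).
Proof.
move=> ab.
have [nu Hnu] := choice (fun ij : 'I_m * 'I_n =>
  tilt_probability mu psi2_gt0 _ (ab ij.1 ij.2)).
have [P PP] := product_law_exists (fun i j => nu (i, j)).
exists P; split.
- by move=> S mS; rewrite PP//; apply: eq_bigr => i _; apply: eq_bigr => j _;
    rewrite (Hnu (i, j)).1.
- move=> i j; rewrite (product_law_expectation _ _ i j PP) (Hnu (i, j)).2/=.
  by rewrite /mean_table [in RHS]mxE.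
Qed.

End duality.

Theorem theorem1p7 (R : realType)
  (mu : {sigma_finite_measure set (measurableTypeR R) -> \bar R})
  (Theta_nontrivial : exists t1 t2, [/\ Theta mu t1, Theta mu t2 & t1 <> t2])
  (psi2_gt0 : forall t, (Theta mu)° t -> 0 < (psi mu)^`(2) t)
  (dpsi_bij : set_bij (Theta mu)° (mean_domain mu) ((psi mu)^`()))
  (m n : nat) (r : 'rV[R]_m) (c : 'rV[R]_n) :
  [/\ (exists a b, is_MLE mu r c a b) <-> (exists Z, is_typical_table mu r c Z),
      (exists Z, is_typical_table mu r c Z) <->
        margin_tables r c `&` [set Z : 'M[R]_(m, n) | forall i j, mean_domain mu (Z i j)]
          !=set0 &
      forall Z, is_typical_table mu r c Z ->
        (forall a b, admissible mu a b ->
           [/\ is_MLE mu r c a b <-> margin_tables r c (mean_table mu a b),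
               margin_tables r c (mean_table mu a b) <-> Z = mean_table mu a b &
               exists P : probability (@mx_measurable R m n) R,
                 is_product_law (fun i j => tilt mu (oplus a b i j)) P /\
                 has_mean_matrix P (mean_table mu a b)]) /\
        ereal_inf (table_entropy mu @` margin_tables r c) =
        ereal_sup [set x | exists a b,
                     admissible mu a b /\ x = (loglik mu r c a b)%:E]].
Proof.
have MLE_of_table := MLE_exists mu Theta_nontrivial psi2_gt0 dpsi_bij r c.
have typical_of := typical_of_MLE mu psi2_gt0 dpsi_bij r c.
have MLE_of := MLE_of_typical mu Theta_nontrivial psi2_gt0 dpsi_bij r c.
split.
- split=> [[a [b M]]|[Z tZ]]; last exact: MLE_of tZ.
  by exists (mean_table mu a b); exact: typical_of.
- split=> [[Z tZ]|[Z [TZ ZD]]].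
    exists Z; split; first by case: tZ.
    exact: (typical_mean_domain mu Theta_nontrivial psi2_gt0 dpsi_bij r c Z tZ).
  have [a [b M]] := MLE_of_table Z TZ ZD.
  by exists (mean_table mu a b); exact: typical_of.
- move=> Z tZ; split=> [a b ab|]; last first.
    exact: (strong_duality mu Theta_nontrivial psi2_gt0 dpsi_bij r c Z tZ).
  split.
  + exact: (MLE_mean_table mu psi2_gt0 r c a b ab).
  + split=> [TM|<-]; last by case: tZ.
    exact: (typical_eq_mean_table mu Theta_nontrivial psi2_gt0 dpsi_bij r c Z a b tZ ab TM).
  + exact: (mean_table_product_law mu psi2_gt0 a b ab).
Qed.
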